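(* Let $\mathcal C$ be a semi-$\mathcal Z$-prenormal category. Let $\mathcal F$ be a $\mathcal Z$-torsion-free subcategory of $\mathcal C$, and let $F\colon\mathcal C\to\mathcal F$ be the left adjoint to the inclusion $\mathcal F\hookrightarrow\mathcal C$. Then $\mathcal F$ is $\mathcal Z$-hereditary if and only if $F$ preserves maps with $\mathcal Z$-trivial $\mathcal Z$-kernel (i.e. whenever $f$ is a morphism of $\mathcal C$ with $\mathcal Z$-trivial $\mathcal Z$-kernel, so is $F(f)$).
   Context: Let $\mathcal C$ be a category and $\mathcal Z$ a full replete subcategory (the trivial objects). A morphism of $\mathcal C$ is $\mathcal Z$-trivial if it factors through an object of $\mathcal Z$. A $\mathcal Z$-kernel of $f\colon A\to B$ is a pair $(K,k\colon K\to A)$ such that $f\circ k$ is $\mathcal Z$-trivial and every $x\colon X\to A$ with $f\circ x$ $\mathcal Z$-trivial factors uniquely as $x=k\circ x'$. A $\mathcal Z$-cokernel is defined dually. A $\mathcal Z$-normal monomorphism (resp. $\mathcal Z$-normal epimorphism) is a morphism that is a $\mathcal Z$-kernel (resp. $\mathcal Z$-cokernel) of some morphism. A sequence $A\xrightarrow{f}B\xrightarrow{g}C$ is $\mathcal Z$-exact if $(A,f)$ is the $\mathcal Z$-kernel of $g$ and $(C,g)$ is the $\mathcal Z$-cokernel of $f$. A morphism has $\mathcal Z$-trivial $\mathcal Z$-kernel if its $\mathcal Z$-kernel $(K,k)$ exists and $k$ is a $\mathcal Z$-trivial morphism. $\mathcal C$ is semi-$\mathcal Z$-prenormal if $\mathcal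 Z$ is mono-coreflective in $\mathcal C$ (the inclusion has a right adjoint and the counit components are monomorphisms) and: (1) $\mathcal C$ has pullbacks along $\mathcal Z$-normal monomorphisms; (2) $\mathcal C$ has $\mathcal Z$-cokernels of $\mathcal Z$-kernels; (3) the pullback of a $\mathcal Z$-normal epimorphism along a $\mathcal Z$-normal monomorphism is a $\mathcal Z$-normal epimorphism. A $\mathcal Z$-torsion theory on $\mathcal C$ is a pair $(\mathcal T,\mathcal F)$ of full replete subcategories such that every morphism $A\to B$ with $A\in\mathcal T$, $B\in\mathcal F$ is $\mathcal Z$-trivial, and for every object $X$ there is a $\mathcal Z$-exact sequence $A\to X\to B$ with $A\in\mathcal T$ and $B\in\mathcal F$. A subcategory $\mathcal F$ is $\mathcal Z$-torsion-free if there is a $\mathcal T$ such that $(\mathcal T,\mathcal F)$ is a $\mathcal Z$-torsion theory; in this case $\mathcal F$ is reflective in $\mathcal C$ and $\mathcal T$ is uniquely determined by $\mathcal F$. The $\mathcal Z$-torsion theory $(\mathcal T,\mathcal F)$ (and the subcategory $\mathcal F$) is $\mathcal Z$-hereditary if for every morphism $X\to Y$ with $\mathcal Z$-trivial $\mathcal Z$-kernel such that $Y\in\mathcal T$, the object $X$ is also in $\mathcal T$. *)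

(* Defs.v *)
Set Implicit Arguments.
Unset Strict Implicit.
Unset Printing Implicit Defensive.

Declare Scope cat_scope.
Delimit Scope cat_scope with cat.
Local Open Scope cat_scope.

Record category : Type := Category {
  obj :> Type;
  hom : obj -> obj -> Type;
  idm : forall A : obj, hom A A;
  comp : forall A B D : obj, hom B D -> hom A B -> hom A D;
  comp_assoc : forall (A B D E : obj) (h : hom D E) (g : hom B D) (f : hom A B),
    comp h (comp g f) = comp (comp h g) f;
  comp_id_l : forall (A B : obj) (f : hom A B), comp (idm B) f = f;
  comp_id_r : forall (A B : obj) (f : hom A B), comp f (idm A) = f
}.

Arguments hom {c} _ _.
Arguments idm {c} _.
Arguments comp {c A B D} _ _.

Notation "g ∘ f" := (comp g f) (at level 40, left associativity) : cat_scope.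

Definition mono (C : category) (A B : C) (m : hom A B) : Prop :=
  forall (X : C) (u v : hom X A), m ∘ u = m ∘ v -> u = v.

Definition isomorphic (C : category) (A B : C) : Prop :=
  exists (f : hom A B) (g : hom B A), g ∘ f = idm A /\ f ∘ g = idm B.

Definition is_pullback (C : category) (A B D P : C)
    (f : hom A D) (g : hom B D) (p : hom P A) (q : hom P B) : Prop :=
  f ∘ p = g ∘ q /\
  forall (X : C) (x : hom X A) (y : hom X B), f ∘ x = g ∘ y ->
    exists! u : hom X P, p ∘ u = x /\ q ∘ u = y.

Record functor (C D : category) : Type := Functor {
  fobj :> C -> D;
  fmap : forall A B : C, hom A B -> hom (fobj A) (fobj B);
  fmap_id : forall A : C, fmap (idm A) = idm (fobj A);
  fmap_comp : forall (A B E : C) (g : hom B E) (f : hom A B),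
    fmap (g ∘ f) = fmap g ∘ fmap f
}.

Arguments fmap {C D} _ {A B} _.

(* [adjunction L R] : L is left adjoint to R *)
Record adjunction (C D : category) (L : functor C D) (R : functor D C) : Type :=
  Adjunction {
    unit : forall A : C, hom A (R (L A));
    counit : forall B : D, hom (L (R B)) B;
    unit_natural : forall (A A' : C) (f : hom A A'),
      fmap R (fmap L f) ∘ unit A = unit A' ∘ f;
    counit_natural : forall (B B' : D) (g : hom B B'),
      g ∘ counit B = counit B' ∘ fmap L (fmap R g);
    triangle_l : forall A : C, counit (L A) ∘ fmap L (unit A) = idm (L A);
    triangle_r : forall B : D, fmap R (counit B) ∘ unit (R B) = idm (R B)
  }.

(* A full replete subcategory, given by its class of objects. *)
Record full_replete (C : category) : Type := FullReplete {
  mem :> C -> Prop;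
  mem_iso : forall A B : C, isomorphic A B -> mem A -> mem B
}.

Definition full_subcategory (C : category) (S : full_replete C) : category :=
  @Category {A : C | S A}
    (fun A B => hom (proj1_sig A) (proj1_sig B))
    (fun A => idm (proj1_sig A))
    (fun A B D g f => g ∘ f)
    (fun A B D E h g f => comp_assoc h g f)
    (fun A B f => comp_id_l f)
    (fun A B f => comp_id_r f).

Definition inclusion (C : category) (S : full_replete C) :
    functor (full_subcategory S) C :=
  @Functor (full_subcategory S) C
    (fun A => proj1_sig A)
    (fun A B f => f)
    (fun A => eq_refl)
    (fun A B E g f => eq_refl).

Definition mono_coreflective (C : category) (S : full_replete C) : Prop :=
  exists (R : functor C (full_subcategory S)) (adj : adjunction (inclusion S) R),
    forall A : C, mono (counit adj A).

Definition trivial (C : category) (Z : full_replete C) (A B : C) (f : hom A B) : Prop :=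
  exists W : C, Z W /\ exists (a : hom A W) (b : hom W B), f = b ∘ a.

Definition is_kernel (C : category) (Z : full_replete C)
    (A B : C) (f : hom A B) (K : C) (k : hom K A) : Prop :=
  trivial Z (f ∘ k) /\
  forall (X : C) (x : hom X A), trivial Z (f ∘ x) ->
    exists! x' : hom X K, x = k ∘ x'.

Definition is_cokernel (C : category) (Z : full_replete C)
    (A B : C) (f : hom A B) (Q : C) (q : hom B Q) : Prop :=
  trivial Z (q ∘ f) /\
  forall (Y : C) (y : hom B Y), trivial Z (y ∘ f) ->
    exists! y' : hom Q Y, y = y' ∘ q.

Definition normal_mono (C : category) (Z : full_replete C)
    (K A : C) (k : hom K A) : Prop :=
  exists (B : C) (f : hom A B), is_kernel Z f k.

Definition normal_epi (C : category) (Z : full_replete C)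
    (B Q : C) (q : hom B Q) : Prop :=
  exists (A : C) (f : hom A B), is_cokernel Z f q.

Definition exact (C : category) (Z : full_replete C)
    (A B D : C) (f : hom A B) (g : hom B D) : Prop :=
  is_kernel Z g f /\ is_cokernel Z f g.

Definition has_trivial_kernel (C : category) (Z : full_replete C)
    (A B : C) (f : hom A B) : Prop :=
  exists (K : C) (k : hom K A), is_kernel Z f k /\ trivial Z k.

Record semi_prenormal (C : category) (Z : full_replete C) : Prop := SemiPrenormal {
  spn_coreflective : mono_coreflective Z;
  spn_pullbacks : forall (M A B : C) (m : hom M B) (f : hom A B),
    normal_mono Z m ->
    exists (P : C) (p : hom P A) (q : hom P M), is_pullback f m p q;
  spn_cokernels : forall (K A B : C) (f : hom A B) (k : hom K A),
    is_kernel Z f k ->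
    exists (Q : C) (q : hom A Q), is_cokernel Z k q;
  spn_stable : forall (A B M P : C) (e : hom A B) (m : hom M B)
      (p : hom P A) (q : hom P M),
    normal_epi Z e -> normal_mono Z m -> is_pullback e m p q ->
    normal_epi Z q
}.

Definition torsion_theory (C : category) (Z T F : full_replete C) : Prop :=
  (forall (A B : C) (f : hom A B), T A -> F B -> trivial Z f) /\
  (forall X : C, exists (A B : C) (f : hom A X) (g : hom X B),
     T A /\ F B /\ exact Z f g).

Definition torsion_free (C : category) (Z F : full_replete C) : Prop :=
  exists T : full_replete C, torsion_theory Z T F.

Definition hereditary_torsion_theory (C : category) (Z T F : full_replete C) : Prop :=
  torsion_theory Z T F /\
  forall (X Y : C) (f : hom X Y), has_trivial_kernel Z f -> T Y -> T X.

Definition hereditary (C : category) (Z F : full_replete C) : Prop :=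
  exists T : full_replete C, hereditary_torsion_theory Z T F.

(* Main.v *)
Require Import Defs.

(** Write [η_X : X -> F X] for the unit of the reflection.  The reflection of
    [X] into the torsion-free part is also the [Z]-cokernel of the torsion part
    [t_X : T X -> X], so that [T X -> X -> F X] is the [Z]-exact sequence of the
    torsion theory ([unit_exact]) and [X] is torsion exactly when [η_X] is
    trivial.

    If [F] preserves maps with trivial kernel and [f : X -> Y] is such a map
    with [Y] torsion, then [F f ∘ η_X = η_Y ∘ f] is trivial because [η_Y] is;
    since [F f] has trivial kernel it reflects triviality, so [η_X] is trivial
    and [X] is torsion.

    Conversely, assume heredity and let [f : A -> B] have trivial kernel.  Let
    [k : K -> F A] be the kernel of [F f] and pull it back along [η_A] to
    [p : P -> A], with second projection [q : P -> K].  Since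
    [η_B ∘ f ∘ p = F f ∘ k ∘ q] is trivial, [f ∘ p] factors through [t_B] by
    some [w : P -> T B].  Both [f] and the kernel [p] reflect triviality, hence
    so does [w], and heredity makes [P] torsion.  Then [k ∘ q = η_A ∘ p] goes
    from a torsion object to a torsion-free one, so it is trivial, and so is
    [q].  But [q] is a normal epimorphism, as a pullback of [η_A] along a normal
    monomorphism, and a trivial normal epimorphism has a trivial codomain
    ([trivial_cokernel_codomain]); therefore [k] is trivial. *)

Set Implicit Arguments.
Unset Strict Implicit.
Local Open Scope cat_scope.

(** * Trivial morphisms, kernels and cokernels *)

Lemma trivial_precomp (C : category) (Z : full_replete C) (A B D : C)
    (g : hom B D) (f : hom A B) : trivial Z g -> trivial Z (g ∘ f).
Proof.
  intros (W & ZW & a & b & ->).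
  exists W; split; [exact ZW|].
  exists (a ∘ f), b. symmetry; apply comp_assoc.
Qed.

Lemma trivial_postcomp (C : category) (Z : full_replete C) (A B D : C)
    (g : hom B D) (f : hom A B) : trivial Z f -> trivial Z (g ∘ f).
Proof.
  intros (W & ZW & a & b & ->).
  exists W; split; [exact ZW|].
  exists a, (g ∘ b). apply comp_assoc.
Qed.

Lemma trivial_from (C : category) (Z : full_replete C) (W A : C)
    (f : hom W A) : Z W -> trivial Z f.
Proof.
  intros ZW. exists W; split; [exact ZW|].
  exists (idm W), f. symmetry; apply comp_id_r.
Qed.

Lemma trivial_to (C : category) (Z : full_replete C) (A W : C)
    (f : hom A W) : Z W -> trivial Z f.
Proof.
  intros ZW. exists W; split; [exact ZW|].
  exists f, (idm W). symmetry; apply comp_id_l.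
Qed.

Lemma kernel_mono (C : category) (Z : full_replete C) (A B K : C)
    (f : hom A B) (k : hom K A) : is_kernel Z f k -> mono k.
Proof.
  intros [fk0 univ] X u v e.
  assert (fku0 : trivial Z (f ∘ (k ∘ u))).
  { rewrite comp_assoc. now apply trivial_precomp. }
  destruct (univ X (k ∘ u) fku0) as (x & _ & uniq).
  now rewrite <- (uniq u eq_refl), <- (uniq v e).
Qed.

Lemma cokernel_epi (C : category) (Z : full_replete C) (A B Q Y : C)
    (f : hom A B) (q : hom B Q) (u v : hom Q Y) :
  is_cokernel Z f q -> u ∘ q = v ∘ q -> u = v.
Proof.
  intros [qf0 univ] e.
  assert (uqf0 : trivial Z ((u ∘ q) ∘ f)).
  { rewrite <- comp_assoc. now apply trivial_postcomp. }
  destruct (univ Y (u ∘ q) uqf0) as (y & _ & uniq).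
  now rewrite <- (uniq u eq_refl), <- (uniq v e).
Qed.

(** Every map out of an object of [Z] into [A] lifts along a kernel into [A],
    because it becomes trivial after any composition; so a factorisation of
    [k ∘ x] through [Z] can be lifted to one of [x]. *)
Lemma kernel_reflects_trivial (C : category) (Z : full_replete C)
    (A B K X : C) (f : hom A B) (k : hom K A) (x : hom X K) :
  is_kernel Z f k -> trivial Z (k ∘ x) -> trivial Z x.
Proof.
  intros ker (W & ZW & a & b & e).
  assert (fb0 : trivial Z (f ∘ b)) by now apply trivial_from.
  destruct (proj2 ker W b fb0) as (b' & eb & _).
  exists W; split; [exact ZW|]. exists a, b'.
  apply (kernel_mono ker). now rewrite e, eb, comp_assoc.
Qed.

(** If [q = b ∘ a] through an object of [Z], then [a] extends along the cokernel
    [q], which makes [b] a split epimorphism. *)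
Lemma trivial_cokernel_codomain (C : category) (Z : full_replete C)
    (A B Q : C) (f : hom A B) (q : hom B Q) :
  is_cokernel Z f q -> trivial Z q -> trivial Z (idm Q).
Proof.
  intros coker (W & ZW & a & b & e).
  assert (af0 : trivial Z (a ∘ f)) by now apply trivial_to.
  destruct (proj2 coker W a af0) as (y & ea & _).
  exists W; split; [exact ZW|]. exists y, b.
  apply (cokernel_epi coker).
  now rewrite comp_id_l, <- comp_assoc, <- ea.
Qed.

Lemma trivial_kernel_reflects_trivial (C : category) (Z : full_replete C)
    (A B X : C) (f : hom A B) (x : hom X A) :
  has_trivial_kernel Z f -> trivial Z (f ∘ x) -> trivial Z x.
Proof.
  intros (K & k & ker & k0) fx0.
  destruct (proj2 ker X x fx0) as (x' & -> & _).
  now apply trivial_precomp.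
Qed.

(** With [g] an identity this constructs kernels, as pullbacks of kernels of
    identities. *)
Lemma pullback_kernel (C : category) (Z : full_replete C) (A B D M P : C)
    (g : hom B D) (m : hom M B) (f : hom A B) (p : hom P A) (q : hom P M) :
  is_kernel Z g m -> is_pullback f m p q -> is_kernel Z (g ∘ f) p.
Proof.
  intros ker [sq univ]. split.
  - rewrite <- comp_assoc, sq, comp_assoc.
    apply trivial_precomp, ker.
  - intros X x gfx0. rewrite <- comp_assoc in gfx0.
    destruct (proj2 ker X (f ∘ x) gfx0) as (y & ey & _).
    destruct (univ X x y ey) as (u & [pu _] & uniq).
    exists u; split; [now symmetry|].
    intros u' eu'. apply uniq. split; [now symmetry|].
    apply (kernel_mono ker).
    now rewrite <- ey, eu', !comp_assoc, sq.
Qed.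

Lemma exact_iso_right (C : category) (Z : full_replete C) (A B D E : C)
    (f : hom A B) (g : hom B D) (j : hom D E) (h : hom E D) :
  h ∘ j = idm D -> j ∘ h = idm E -> exact Z f g -> exact Z f (j ∘ g).
Proof.
  intros hj jh [[gf0 univ] coker]. split; split.
  - rewrite <- comp_assoc. now apply trivial_postcomp.
  - intros X x jgx0. apply univ.
    rewrite <- (comp_id_l g), <- hj, <- (comp_assoc h j g), <- comp_assoc.
    now apply trivial_postcomp.
  - rewrite <- comp_assoc. now apply trivial_postcomp.
  - intros Y y yf0.
    destruct (proj2 coker Y y yf0) as (y' & ey & _).
    exists (y' ∘ h). split.
    + now rewrite comp_assoc, <- (comp_assoc y' h j), hj, comp_id_r.
    + intros z ez.
      assert (ezj : z ∘ j = y').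
      { apply (cokernel_epi coker). now rewrite <- ey, ez, comp_assoc. }
      now rewrite <- ezj, <- comp_assoc, jh, comp_id_r.
Qed.

(** The counit at [B] is the kernel of the identity of [B]: a map into [B] is
    trivial exactly when it factors through the coreflection of [B]. *)
Lemma kernel_of_identity_exists (C : category) (Z : full_replete C) (B : C) :
  mono_coreflective Z ->
  exists (K : C) (k : hom K B), is_kernel Z (idm B) k.
Proof.
  intros (R & adj & counit_mono).
  exists (proj1_sig (R B)), (counit adj B). split.
  - apply trivial_postcomp, trivial_from, proj2_sig.
  - intros X x. rewrite comp_id_l. intros (W & ZW & a & b & ->).
    (* the transpose of [b] across the adjunction *)
    set (W' := exist _ W ZW : full_subcategory Z).
    set (b' := (fmap R (b : hom (inclusion Z W') B) ∘ unit adj W'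
                : hom W' (R B)) : hom W (proj1_sig (R B))).
    assert (eb : counit adj B ∘ b' = b).
    { unfold b'.
      pose proof (counit_natural adj (b : hom (inclusion Z W') B)) as nat.
      pose proof (triangle_l adj W') as tri. simpl in *.
      now rewrite comp_assoc, <- nat, <- comp_assoc, tri, comp_id_r. }
    exists (b' ∘ a). split.
    + rewrite <- eb. symmetry; apply comp_assoc.
    + intros x' ex. apply (counit_mono B).
      transitivity (b ∘ a); [|exact ex].
      rewrite <- eb. apply comp_assoc.
Qed.

Lemma kernel_exists (C : category) (Z : full_replete C)
    (hC : semi_prenormal Z) (A B : C) (f : hom A B) :
  exists (K : C) (k : hom K A), is_kernel Z f k.
Proof.
  destruct (kernel_of_identity_exists B (spn_coreflective hC)) as (M & m & ker).
  assert (m_normal : normal_mono Z m) by (eexists; eexists; exact ker).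
  destruct (spn_pullbacks hC f m_normal) as (P & p & q & pb).
  exists P, p. rewrite <- (comp_id_l f). exact (pullback_kernel ker pb).
Qed.

(** * The reflection and the torsion theory *)

Lemma unit_factorization (C : category) (F : full_replete C)
    (L : functor C (full_subcategory F)) (adj : adjunction L (inclusion F))
    (X B : C) (FB : F B) (g : hom X B) :
  exists h : hom (inclusion F (L X)) B, h ∘ unit adj X = g.
Proof.
  set (B' := exist _ B FB : full_subcategory F).
  exists (counit adj B' ∘ fmap L (g : hom X (inclusion F B'))).
  pose proof (unit_natural adj (g : hom X (inclusion F B'))) as nat.
  pose proof (triangle_r adj B') as tri. simpl in *.
  now rewrite <- comp_assoc, nat, comp_assoc, tri, comp_id_l.
Qed.

Lemma unit_cancel (C : category) (F : full_replete C)
    (L : functor C (full_subcategory F)) (adj : adjunction L (inclusion F))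
    (X : C) (B : full_subcategory F) (u v : hom (L X) B) :
  fmap (inclusion F) u ∘ unit adj X = fmap (inclusion F) v ∘ unit adj X ->
  u = v.
Proof.
  intros e.
  assert (transpose : forall w : hom (L X) B,
    w = counit adj B ∘ fmap L (fmap (inclusion F) w ∘ unit adj X)).
  { intros w.
    rewrite (fmap_comp L), comp_assoc, <- (counit_natural adj w), <- comp_assoc.
    now rewrite (triangle_l adj X), comp_id_r. }
  now rewrite (transpose u), (transpose v), e.
Qed.

(** The torsion-free quotient of [X] is a reflection, since maps from torsion to
    torsion-free objects are trivial and so factor through the cokernel of the
    torsion part; it therefore agrees with the unit up to an isomorphism. *)
Lemma unit_exact (C : category) (Z T F : full_replete C)
    (tt : torsion_theory Z T F)
    (L : functor C (full_subcategory F)) (adj : adjunction L (inclusion F))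
    (X : C) :
  exists (A : C) (t : hom A X), T A /\ exact Z t (unit adj X).
Proof.
  destruct tt as [TF0 decomp].
  destruct (decomp X) as (A & B & t & g & TA & FB & ex).
  exists A, t; split; [exact TA|].
  destruct (unit_factorization adj FB g) as (h & eh).
  assert (t0 : trivial Z (unit adj X ∘ t)).
  { apply TF0; [exact TA | exact (proj2_sig (L X))]. }
  destruct ex as [ker coker].
  destruct (proj2 coker _ _ t0) as (j & ej & _).
  rewrite ej. apply (@exact_iso_right C Z _ _ _ _ t g j h).
  - apply (cokernel_epi coker).
    now rewrite comp_id_l, <- comp_assoc, <- ej.
  - apply (@unit_cancel C F L adj X (L X) (j ∘ h) (idm (L X))). simpl.
    rewrite comp_id_l. transitivity (j ∘ (h ∘ unit adj X)).
    + symmetry; apply comp_assoc.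
    + now rewrite eh, <- ej.
  - now split.
Qed.

(** When the unit is trivial, the identity factors through the torsion part,
    which is then all of [X]. *)
Lemma torsion_of_trivial_unit (C : category) (Z T F : full_replete C)
    (tt : torsion_theory Z T F)
    (L : functor C (full_subcategory F)) (adj : adjunction L (inclusion F))
    (X : C) :
  trivial Z (unit adj X) -> T X.
Proof.
  intros eta0.
  destruct (unit_exact tt adj X) as (A & t & TA & ker & _).
  destruct (proj2 ker X (idm X)) as (s & es & _).
  { now rewrite comp_id_r. }
  apply (@mem_iso C T A X); [|exact TA].
  exists t, s. split; [|now symmetry].
  apply (kernel_mono ker).
  now rewrite comp_assoc, <- es, comp_id_l, comp_id_r.
Qed.

(** * Heredity and preservation of maps with trivial kernel *)

Lemma hereditary_preserves_trivial_kernel (C : category) (Z T F : full_replete C)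
    (hC : semi_prenormal Z) (hT : hereditary_torsion_theory Z T F)
    (L : functor C (full_subcategory F)) (adj : adjunction L (inclusion F))
    (A B : C) (f : hom A B) :
  has_trivial_kernel Z f ->
  has_trivial_kernel Z (fmap (inclusion F) (fmap L f)).
Proof.
  intros f_tk. destruct hT as [tt her].
  destruct (kernel_exists hC (fmap (inclusion F) (fmap L f))) as (K & k & kerk).
  exists K, k; split; [exact kerk|].
  assert (k_normal : normal_mono Z k) by (eexists; eexists; exact kerk).
  destruct (unit_exact tt adj A) as (TA & tA & _ & _ & cokerA).
  destruct (unit_exact tt adj B) as (TB & tB & TTB & kerB & _).
  destruct (spn_pullbacks hC (unit adj A) k_normal) as (P & p & q & pb).
  assert (q_normal : normal_epi Z q).
  { apply (spn_stable hC (e := unit adj A) (m := k) (p := p));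
      [eexists; eexists; exact cokerA | exact k_normal | exact pb]. }
  pose proof (pullback_kernel kerk pb) as kerp.
  (* [kerp] says in particular that [η_B ∘ f ∘ p] is trivial, by naturality. *)
  assert (fp0 : trivial Z (unit adj B ∘ (f ∘ p))).
  { rewrite comp_assoc, <- unit_natural. apply kerp. }
  destruct (proj2 kerB P (f ∘ p) fp0) as (w & ew & _).
  assert (w_tk : has_trivial_kernel Z w).
  { destruct (kernel_exists hC w) as (N & n & kern).
    exists N, n; split; [exact kern|].
    apply (kernel_reflects_trivial kerp).
    apply (trivial_kernel_reflects_trivial f_tk).
    rewrite comp_assoc, ew, <- comp_assoc.
    apply trivial_postcomp, kern. }
  assert (TP : T P) by exact (her _ _ w w_tk TTB).
  assert (q0 : trivial Z q).
  { apply (kernel_reflects_trivial kerk).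
    apply (proj1 tt); [exact TP | exact (proj2_sig (L A))]. }
  destruct q_normal as (S & s & cokers).
  rewrite <- (comp_id_r k).
  apply trivial_postcomp, (trivial_cokernel_codomain cokers q0).
Qed.

Lemma hereditary_of_preserves_trivial_kernel (C : category)
    (Z T F : full_replete C) (tt : torsion_theory Z T F)
    (L : functor C (full_subcategory F)) (adj : adjunction L (inclusion F)) :
  (forall (A B : C) (f : hom A B),
     has_trivial_kernel Z f ->
     has_trivial_kernel Z (fmap (inclusion F) (fmap L f))) ->
  hereditary_torsion_theory Z T F.
Proof.
  intros pres. split; [exact tt|].
  intros X Y f f_tk TY.
  apply (torsion_of_trivial_unit tt (adj := adj)).
  apply (trivial_kernel_reflects_trivial (pres _ _ f f_tk)).
  rewrite unit_natural. apply trivial_precomp.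
  apply (proj1 tt); [exact TY | exact (proj2_sig (L Y))].
Qed.

Unset Implicit Arguments.

Theorem proposition6p2 (C : category) (Z : full_replete C) (hC : semi_prenormal Z)
    (F : full_replete C) (hF : torsion_free Z F)
    (L : functor C (full_subcategory F)) (adj : adjunction L (inclusion F)) :
  hereditary Z F <->
  (forall (A B : C) (f : hom A B),
     has_trivial_kernel Z f ->
     has_trivial_kernel Z (fmap (inclusion F) (fmap L f))).
Proof.
  split.
  - intros [T hT].
    exact (hereditary_preserves_trivial_kernel hC hT adj).
  - intros pres. destruct hF as [T tt]. exists T.
    exact (hereditary_of_preserves_trivial_kernel tt adj pres).
Qed.
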